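(* Let $\mu$ be any probability measure on $\mathbb{N}=\{1,2,\ldots\}$, and let $\lambda$ be any extremal $\mu$-Gibbs measure. Let $X,Y\in L^2(\lambda)$ be two increasing real-valued functions on $\{-1,1\}^{\mathbb{Z}}$, where $\{-1,1\}^{\mathbb{Z}}$ is given its natural (coordinatewise) partial order. Then $X$ and $Y$ are not negatively correlated under $\lambda$, that is, $\mathrm{Cov}_\lambda(X,Y)\geq 0$.
   Context: $G_\mu$ is the random directed graph with vertex set $\mathbb{Z}$ in which each $z\in\mathbb{Z}$ has a unique outgoing edge, pointing to its parent $z-k_z$, where $(k_z)_{z\in\mathbb{Z}}$ are independent with law $\mu$. The ancestral line of $z$ is the decreasing sequence whose first element is $z$ and each of whose terms is the parent of the previous one; its elements are the ancestors of $z$. A probability law $\lambda$ on functions $\mathbb{Z}\to\{-1,1\}$ is a $\mu$-Gibbs measure if, for every half-infinite interval $R=\{x,x+1,\ldots\}$ ($x\in\mathbb{Z}$), the conditional law under $\lambda$ of the values on $R$, given the values on $R^c$, is given by sampling $G_\mu$ and assigning to each element of $R$ the value assigned to its most recent ancestor in $R^c$ (i.e. the largest element of its ancestral line lying in $R^c$). A $\mu$-Gibbs measure is extremal if it cannot be written as an average of two distinct $\mu$-Gibbs measures. *)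

(* Defs.v *)
From HB Require Import structures.
From mathcomp Require Import all_boot all_order all_algebra.
From mathcomp Require Import all_classical all_reals all_analysis.
From mathcomp Require Import measurable_realfun.
Set Implicit Arguments.
Unset Strict Implicit.
Unset Printing Implicit Defensive.
Import Order.TTheory GRing.Theory Num.Theory numFieldNormedType.Exports.
Local Open Scope classical_set_scope.
Local Open Scope ring_scope.

(* The set {-1, 1} is encoded by [bool], with its order false < true: [false]
   stands for -1 and [true] for 1. *)

Definition coordinate_events (S : set int) : set (set (int -> bool)) :=
  [set A | exists z b, S z /\ A = [set s | s z = b]].

(* The generated sigma-algebra is the product sigma-algebra. *)
Definition config : Type := g_sigma_algebraType (coordinate_events setT).

(* k z is the length of the unique edge out of z. *)
Definition parent (k : int -> nat) (z : int) : int := z - (k z)%:Z.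

Definition ancestral_line (k : int -> nat) (z : int) : set int :=
  range (fun n => iter n (parent k) z).

(* For S the complement of a half-line {x, x+1, ...}, the default value z of
   [xget] occurs only if k vanishes somewhere on the ancestral line: a null event
   when the law of the k z gives no mass to 0. *)
Definition most_recent_ancestor_in (S : set int) (k : int -> nat) (z : int) :
    int :=
  xget z [set a | [/\ ancestral_line k z a, S a &
                      forall b, ancestral_line k z b -> S b -> b <= a]].

Definition half_line (x : int) : set int := [set y | x <= y].

(* The values outside the half-line are unchanged: the ancestral line of z
   starts at z. *)
Definition inherit (x : int) (k : int -> nat) (s : config) : config :=
  fun z => s (most_recent_ancestor_in (~` half_line x) k z).

Section random_graph.
Context {R : realType} {dT : measure_display} {T : measurableType dT}.
Variable P : probability T R.

Definition mutually_independent (k : int -> {RV P >-> nat}) : Prop :=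
  forall (J : seq int) (B : int -> set nat), uniq J ->
    P (\bigcap_(z in [set` J]) (k z @^-1` B z)) =
    (\prod_(z <- J) P (k z @^-1` B z))%E.

(* The family k of edge lengths is a realization, on the probability space
   (T, P), of the random graph of the law mu. *)
Definition random_graph (mu : probability nat R) (k : int -> {RV P >-> nat}) :
    Prop :=
  (forall z (B : set nat), distribution P (k z) B = mu B) /\
  mutually_independent k.

End random_graph.

Section gibbs.
Context {R : realType}.

(* f is a version of the conditional probability of A under lambda, given the
   values of the configuration on S. *)
Definition is_conditional_probability (lambda : probability config R)
    (S : set int) (A : set config) (f : config -> \bar R) : Prop :=
  measurable_fun [set: g_sigma_algebraType (coordinate_events S)] f /\
  forall B : set config, <<s coordinate_events S >> B ->
    lambda (A `&` B) = (\int[lambda]_(s in B) f s)%E.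

Context {dT : measure_display} {T : measurableType dT}.
Variables (P : probability T R) (k : int -> {RV P >-> nat}).

Definition gibbs (lambda : probability config R) : Prop :=
  forall (x : int) (A : set config),
    <<s coordinate_events (half_line x) >> A ->
    is_conditional_probability lambda (~` half_line x) A
      (fun s => P [set w | A (inherit x (fun z => k z w) s)]).

Definition extremal_gibbs (lambda : probability config R) : Prop :=
  gibbs lambda /\
  forall lambda1 lambda2 : probability config R,
    gibbs lambda1 -> gibbs lambda2 ->
    (forall A : set config, measurable A ->
       lambda A = ((2^-1)%:E * (lambda1 A + lambda2 A))%E) ->
    forall A : set config, measurable A -> lambda1 A = lambda2 A.

End gibbs.

Definition increasing {R : realType} (X : config -> R) : Prop :=
  forall s t : config, (forall z, (s z <= t z)%O) -> X s <= X t.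

(* Main.v *)
Require Import Defs.
From HB Require Import structures.
From mathcomp Require Import all_boot all_order all_algebra.
From mathcomp Require Import all_classical all_reals all_analysis.
From mathcomp Require Import measurable_realfun.
From mathcomp Require Import ring lra zify.
Import Order.TTheory GRing.Theory Num.Theory numFieldNormedType.Exports.
Local Open Scope classical_set_scope.
Local Open Scope ring_scope.
Set Implicit Arguments.
Unset Strict Implicit.
Unset Printing Implicit Defensive.

(** The proof follows the values of the configuration from left to right. For a
    level [m], let [K m X] be the expectation of [X] when the values on
    [{m, m + 1, ...}] are resampled from the graph and the values below [m]; the
    Gibbs property says that it is a conditional expectation of [X] given the
    values below [m] ([gibbs_invariant], [exp_resampled_pull]). Since inheritance
    is monotone in the configuration, [K m X] is increasing when [X] is.

    Going from level [m] to level [m + 1] reveals a single value. Conditionally on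
    the past, [K (m + 1) X] and [K (m + 1) Y] are increasing functions of this one
    bit, hence positively correlated ([resampledM_ge]). So the expectation of
    [K m X * K m Y] increases with [m] ([exp_resampled_le]), and two limits remain.

    As [m] tends to plus infinity, the expectation of [K m X * K m Y] does not
    exceed that of [X * Y], because [X] is approximated in mean by functions of
    the values below some level ([exp_resampled_le_exp]).

    As [m] tends to minus infinity, [K m X] converges to the expectation of [X].
    Here extremality enters: a tail event of probability strictly between 0 and 1
    would split the measure into an average of two distinct Gibbs measures
    ([extremal_tail_trivial]). That [K m X] falls below a constant [a] at
    arbitrarily low levels is a tail event; were it almost sure, stopping at the
    first such level would bound the expectation of [X] by [a]. So for every
    [a] smaller than that expectation, almost surely [a <= K m X] at all low
    levels ([resampled_eventually_ge]). Together these facts give the inequality for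
    functions with values in the unit interval ([unit_positive_association]);
    square-integrable functions are reached by affine rescaling, truncation and
    dominated convergence. *)

(** * Countable combinations of events *)

Lemma measurable_exists {d} {T : measurableType d} {I : countType}
    (F : I -> T -> Prop) :
  (forall i, measurable [set x | F i x]) -> measurable [set x | exists i, F i x].
Proof.
move=> mF; rewrite (_ : [set x | _] = \bigcup_i [set x | F i x]); last first.
  by apply/seteqP; split=> x /=; [move=> [i Fi]; exists i|move=> [i _ Fi]; exists i].
exact: countable_bigcupT_measurable.
Qed.

Lemma measurable_forall {d} {T : measurableType d} {I : countType}
    (F : I -> T -> Prop) :
  (forall i, measurable [set x | F i x]) -> measurable [set x | forall i, F i x].
Proof.
move=> mF; rewrite (_ : [set x | _] = ~` [set x | exists i, ~ F i x]).
  by apply/measurableC/measurable_exists => i; exact: measurableC (mF i).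
apply/seteqP; split=> [x /= Fx [i]|x /= nF i]; first by apply; exact: Fx.
by apply: contrapT => nFi; apply: nF; exists i.
Qed.

Lemma measurable_imply {d} {T : measurableType d} (p : Prop) (F : T -> Prop) :
  measurable [set x | F x] -> measurable [set x | p -> F x].
Proof.
move=> mF; have [hp|np] := pselect p.
  by rewrite (_ : [set x | _] = [set x | F x])//; apply/seteqP; split=> x /=; auto.
by rewrite (_ : [set x | _] = setT)//; apply/seteqP; split=> x //= _ /np.
Qed.

(** * Ancestors and inheritance *)

Lemma ancestral_line_le (kk : int -> nat) (z a : int) :
  ancestral_line kk z a -> a <= z.
Proof.
case=> n _ <-; elim: n => //= n; apply: le_trans.
by rewrite /parent; lia.
Qed.

Lemma most_recent_ancestor_self (S : set int) kk z :
  S z -> most_recent_ancestor_in S kk z = z.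
Proof.
move=> Sz; apply: xget_unique.
  split=> //; first by exists 0%N.
  by move=> b /ancestral_line_le.
move=> a [/ancestral_line_le az _ /(_ z)] za.
by apply/eqP; rewrite eq_le az za//; exists 0%N.
Qed.

Lemma inherit_below x kk (s : config) z : z < x -> inherit x kk s z = s z.
Proof.
move=> zx; rewrite /inherit most_recent_ancestor_self// /half_line /=.
by apply/negP; rewrite -ltNge.
Qed.

Lemma inherit_mono x kk (s t : config) :
  (forall z, (s z <= t z)%O) -> forall z, (inherit x kk s z <= inherit x kk t z)%O.
Proof. by move=> st z; exact: st. Qed.

(** Edges of positive length force the ancestral line out of the half-line, so the
    default value in the definition of the most recent ancestor does not occur. *)
Lemma most_recent_ancestor_below x kk z : (forall y, (0 < kk y)%N) ->
  most_recent_ancestor_in (~` half_line x) kk z < x.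
Proof.
move=> kpos.
pose M := [set a | [/\ ancestral_line kk z a, (~` half_line x) a &
   forall b, ancestral_line kk z b -> (~` half_line x) b -> b <= a]].
suff [a Ma] : exists a, M a.
  by case: (xgetI z Ma) => _ + _; rewrite /half_line /=; move/negP; rewrite -ltNge.
have it n : iter n (parent kk) z + n%:Z <= z.
  elim: n => [|n] /=; first lia.
  by rewrite {2}/parent; have := kpos (iter n (parent kk) z); lia.
have ex : exists n, iter n (parent kk) z < x.
  exists (`|z - x|%N.+1); have := it (`|z - x|%N.+1); lia.
case: (ex_minnP ex) => n nx nmin; exists (iter n (parent kk) z); split.
- by exists n.
- by rewrite /half_line /=; apply/negP; rewrite -ltNge.
- move=> b [j _ <-]; rewrite /half_line /= => /negP; rewrite -ltNge => /nmin nj.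
  rewrite -(subnK nj) iterD; apply: (@ancestral_line_le kk).
  by exists (j - n)%N.
Qed.

Lemma inherit_eq_below x kk (s t : config) : (forall y, (0 < kk y)%N) ->
  (forall z, z < x -> s z = t z) -> inherit x kk s = inherit x kk t.
Proof.
by move=> kpos st; apply/funext => z; apply: st; exact: most_recent_ancestor_below.
Qed.

Lemma coordinate_measurable (z : int) (b : bool) :
  measurable ([set s | s z = b] : set config).
Proof. by apply: sub_sigma_algebra; exists z, b. Qed.

Section inherit_measurable.
Context {d} {T : measurableType d} (k : int -> T -> nat).
Hypothesis mk : forall z, measurable_fun setT (k z).

Let mkz z (j : nat) : measurable [set w | k z w = j].
Proof.
rewrite (_ : [set w | _] = setT `&` k z @^-1` [set j]).
  exact: mk.
by rewrite setTI.
Qed.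

Lemma measurable_ancestral_line z a :
  measurable [set w | ancestral_line (fun y => k y w) z a].
Proof.
rewrite (_ : [set w | _] =
    [set w | exists n, iter n (parent (fun y => k y w)) z = a]); last first.
  by apply/seteqP; split=> w /=; [move=> [n _ na]; exists n|move=> [n na]; exists n].
apply: measurable_exists => n; elim: n z => [|n IHn] z /=.
  have [->|/eqP za] := eqVneq z a.
    by rewrite (_ : [set _ | _] = setT)//; apply/seteqP; split.
  by rewrite (_ : [set _ | _] = set0)//; apply/seteqP; split.
rewrite (_ : [set w | _] = [set w | exists j, k z w = j /\
    iter n (parent (fun y => k y w)) (z - j%:Z) = a]).
  by apply: measurable_exists => j; apply: measurableI; [exact: mkz|exact: IHn].
apply/seteqP; split=> w /=; rewrite -iterS iterSr.
  by move=> <-; exists (k z w).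
by move=> [j [<- <-]].
Qed.

(** Each coordinate of the result reads one of countably many coordinates of the
    configuration, and which one it reads is decided by an event of the graph. *)
Lemma measurable_inherit x : measurable_fun [set: config * T]
  (fun u => inherit x (fun y => k y u.2) u.1).
Proof.
apply: (@measurability _ _ _ config setT _ (coordinate_events setT) erefl).
move=> _ [_ [z [b [_ ->]]] <-]; rewrite setTI.
(* [M z w] has at most one element: the most recent ancestor, if there is one *)
pose M z w := [set a | [/\ ancestral_line (fun y => k y w) z a, (~` half_line x) a &
   forall b, ancestral_line (fun y => k y w) z b -> (~` half_line x) b -> b <= a]].
have M1 w : is_subset1 (M z w).
  move=> a a' [la sa ma] [la' sa' ma']; apply/eqP; rewrite eq_le.
  by rewrite ma'// ma.
have mM a : measurable [set w | M z w a].
  rewrite (_ : [set w | _] = [set w | ancestral_line (fun y => k y w) z a] `&`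
     ([set w | (~` half_line x) a] `&` [set w | forall b,
       (~` half_line x) b -> b <= a \/ ~ ancestral_line (fun y => k y w) z b])).
    apply: measurableI; first exact: measurable_ancestral_line.
    apply: measurableI.
      have [sa|sa] := pselect ((~` half_line x) a).
        by rewrite (_ : [set _ | _] = setT)//; apply/seteqP; split.
      by rewrite (_ : [set _ | _] = set0)//; apply/seteqP; split.
    apply: measurable_forall => c; apply: measurable_imply.
    apply: measurableU.
      have [ca|ca] := pselect (c <= a).
        by rewrite (_ : (fun _ => _) = setT)//; apply/seteqP; split.
      by rewrite (_ : (fun _ => _) = set0)//; apply/seteqP; split.
    by apply: measurableC; exact: measurable_ancestral_line.
  apply/seteqP; split=> w /=.
    move=> [la sa ma]; split=> //; split=> // c sc.
    have [lc|lc] := pselect (ancestral_line (fun y => k y w) z c); last by right.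
    by left; exact: ma.
  by move=> [la [sa ma]]; split=> // c lc sc; case: (ma c sc).
have mM0 : measurable [set w | forall a, ~ M z w a].
  by apply: measurable_forall => a; exact: measurableC (mM a).
rewrite (_ : _ @^-1` _ =
   [set u | exists a : int, M z u.2 a /\ u.1 a = b] `|`
   ([set s : config | s z = b] `*` [set w | forall a, ~ M z w a])).
  apply: measurableU.
    apply: measurable_exists => a.
    rewrite (_ : [set u | _] = [set s : config | s a = b] `*` [set w | M z w a]).
      by apply: measurableX => //; exact: coordinate_measurable.
    by apply/seteqP; split=> u /= [].
  by apply: measurableX => //; exact: coordinate_measurable.
apply/seteqP; split=> -[s w]/=; rewrite /inherit /most_recent_ancestor_in -/(M z w).
  case: xgetP => [a _ Ma sb|nM sb]; [left|right]; last by split.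
  by exists a.
case=> [[a [Ma sb]]|[sb nM]]; last by rewrite xgetPN.
by rewrite (xget_subset1 _ Ma).
Qed.

End inherit_measurable.

(** * Expectations of bounded functions *)

Section bounded.
Context {d} {T : measurableType d} {R : realType}.
Implicit Types f g : T -> R.

(** For a probability measure this implies integrability; since the class is
    closed under the ring operations, integrability then needs no separate
    argument in the computations with expectations. *)
Definition bounded_measurable f :=
  measurable_fun [set: T] f /\ exists M, forall x, `|f x| <= M.

Lemma bounded_measurable_cst (c : R) : bounded_measurable (fun=> c).
Proof. by split=> //; exists `|c|. Qed.

Lemma bounded_measurableD f g : bounded_measurable f -> bounded_measurable g ->
  bounded_measurable (fun x => f x + g x).
Proof.
move=> [mf [M fM]] [mg [N gN]]; split; first exact: measurable_funD.
by exists (M + N) => x; rewrite (le_trans (ler_normD _ _))// lerD.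
Qed.

Lemma bounded_measurableB f g : bounded_measurable f -> bounded_measurable g ->
  bounded_measurable (fun x => f x - g x).
Proof.
move=> [mf [M fM]] [mg [N gN]]; split; first exact: measurable_funB.
by exists (M + N) => x; rewrite (le_trans (ler_normB _ _))// lerD.
Qed.

Lemma bounded_measurableM f g : bounded_measurable f -> bounded_measurable g ->
  bounded_measurable (fun x => f x * g x).
Proof.
move=> [mf [M fM]] [mg [N gN]]; split; first exact: measurable_funM.
by exists (M * N) => x; rewrite normrM ler_pM.
Qed.

Lemma bounded_measurable_norm f : bounded_measurable f ->
  bounded_measurable (fun x => `|f x|).
Proof.
move=> [mf [M fM]]; split; last by exists M => x; rewrite normr_id.
exact: measurableT_comp.
Qed.

Lemma bounded_measurable_indic (A : set T) : measurable A ->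
  bounded_measurable (\1_A : T -> R).
Proof.
move=> mA; split; first exact: measurable_indic.
by exists 1 => x; rewrite indicE; case: (_ \in _); rewrite ?normr1 ?normr0.
Qed.

Definition unit_valued f :=
  measurable_fun [set: T] f /\ forall x, 0 <= f x <= 1.

Lemma unit_bounded f : unit_valued f -> bounded_measurable f.
Proof.
by move=> [mf f01]; split=> //; exists 1 => x; case/andP: (f01 x) => /ger0_norm ->.
Qed.

Lemma unit_valuedM f g : unit_valued f -> unit_valued g ->
  unit_valued (fun x => f x * g x).
Proof.
move=> [mf f01] [mg g01]; split; first exact: measurable_funM.
move=> x; have /andP[f0 f1] := f01 x; have /andP[g0 g1] := g01 x.
by rewrite mulr_ge0//= mulr_ile1.
Qed.

Lemma unit_valued_indic (A : set T) : measurable A -> unit_valued (\1_A : T -> R).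
Proof.
move=> mA; split; first exact: measurable_indic.
by move=> x; rewrite indicE; case: (_ \in _); rewrite /= ?ler01 ?lexx.
Qed.

Variable P : probability T R.
Local Notation E f := (\int[P]_x f x).

Lemma bounded_integrable f : bounded_measurable f ->
  P.-integrable setT (EFin \o f).
Proof.
move=> [mf [M fM]]; apply: measurable_bounded_integrable => //.
  by rewrite (le_lt_trans (probability_le1 _ _))// ltry.
by exists M; split; [exact: num_real|move=> N MN x _; exact: (le_trans (fM x) (ltW MN))].
Qed.

Lemma EFin_Rintegral f : bounded_measurable f ->
  (E f)%:E = (\int[P]_x (f x)%:E)%E.
Proof.
by move=> bf; rewrite fineK//; apply: integrable_fin_num => //; exact: bounded_integrable.
Qed.

Lemma expD f g : bounded_measurable f -> bounded_measurable g ->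
  E (fun x => f x + g x) = E f + E g.
Proof. by move=> bf bg; rewrite RintegralD//; exact: bounded_integrable. Qed.

Lemma expB f g : bounded_measurable f -> bounded_measurable g ->
  E (fun x => f x - g x) = E f - E g.
Proof. by move=> bf bg; rewrite RintegralB//; exact: bounded_integrable. Qed.

Lemma expZ (c : R) f : bounded_measurable f ->
  E (fun x => c * f x) = c * E f.
Proof. by move=> bf; rewrite RintegralZl//; exact: bounded_integrable. Qed.

Lemma exp_cst (c : R) : E (fun=> c) = c.
Proof.
rewrite Rintegral_cst//=.
by rewrite (_ : P setT = 1%E) ?mulr1//; exact: probability_setT.
Qed.

Lemma exp_le f g : bounded_measurable f -> bounded_measurable g ->
  (forall x, f x <= g x) -> E f <= E g.
Proof. by move=> bf bg fg; apply: le_Rintegral => //; exact: bounded_integrable. Qed.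

Lemma exp_indic (A : set T) : measurable A -> E (\1_A) = fine (P A).
Proof. by move=> mA; rewrite /Rintegral integral_indic// setIT. Qed.

Lemma exp_unit f : unit_valued f -> 0 <= E f <= 1.
Proof.
move=> uf; have bf := unit_bounded uf; case: uf => mf f01.
have b c := bounded_measurable_cst c.
apply/andP; split.
  by apply: Rintegral_ge0 => x _; case/andP: (f01 x).
by rewrite -[leRHS](exp_cst 1) exp_le// => x; case/andP: (f01 x).
Qed.

Lemma exp_ae f g : bounded_measurable f -> bounded_measurable g ->
  {ae P, forall x, f x = g x} -> E f = E g.
Proof.
move=> [mf _] [mg _] fg; rewrite /Rintegral; congr fine; apply: ae_eq_integral => //.
- exact/measurable_EFinP.
- exact/measurable_EFinP.
by apply: filterS fg => x -> _.
Qed.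

End bounded.

(** * Resampling a half-line *)

Definition reads_below {V : Type} (m : int) (f : config -> V) : Prop :=
  forall s t : config, (forall z, z < m -> s z = t z) -> f s = f t.

Lemma reads_below_le {V : Type} m n (f : config -> V) : m <= n ->
  reads_below m f -> reads_below n f.
Proof. by move=> mn fm s t st; apply: fm => z /lt_le_trans zm; apply: st; exact: zm. Qed.

(** The property passes from the generators to complements and countable unions.
    It allows functional dependence on coordinates to replace measurability for
    the sub-sigma-algebras in everything that follows. *)
Lemma generated_reads_below m (A : set config) :
  <<s coordinate_events (~` half_line m) >> A -> reads_below m A.
Proof.
suff : <<s coordinate_events (~` half_line m) >> `<=` [set B | reads_below m B].
  by apply.
apply: smallest_sub; first split.
- by [].
- by move=> B mB s t st; rewrite setTD /setC /mkset (mB s t st).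
- move=> F mF s t st; apply/propext; rewrite /bigcup /mkset.
  by split=> -[i _ Fi]; exists i => //; [rewrite -(mF i s t st)|rewrite (mF i s t st)].
- move=> _ [z [b [zm ->]]] s t st; rewrite /mkset st//.
  by move: zm; rewrite /half_line /= => /negP; rewrite -ltNge.
Qed.

Section resampling.
Context {R : realType} {dT : measure_display} {T : measurableType dT}.
Variables (P : probability T R) (k : int -> {RV P >-> nat}).

Definition resample (m : int) (w : T) (s : config) : config :=
  inherit m (fun z => k z w) s.

Lemma measurable_resample m :
  measurable_fun setT (fun u : config * T => resample m u.2 u.1).
Proof.
exact: (@measurable_inherit _ _ (fun z w => k z w)
  (fun z => @measurable_funPT _ _ _ _ (k z)) m).
Qed.

Lemma measurable_resample_graph m s : measurable_fun setT (fun w => resample m w s).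
Proof.
apply: (measurableT_comp (measurable_resample m)
  (_ : measurable_fun setT (fun w => (s, w)))).
exact: measurable_fun_pair.
Qed.

(** The expectation of [f] when the values on the half-line from [m] are
    resampled. Under a Gibbs measure it is a version of the conditional
    expectation of [f] given the values below [m]. *)
Definition resampled (m : int) (f : config -> R) (s : config) : R :=
  \int[P]_w f (resample m w s).

Lemma resample_unit m (f : config -> R) s : unit_valued f ->
  unit_valued (fun w => f (resample m w s)).
Proof.
move=> [mf f01]; split; last by move=> w; exact: f01.
by apply: (measurableT_comp mf); exact: measurable_resample_graph.
Qed.

Lemma resampled_unit m f : unit_valued f -> unit_valued (resampled m f).
Proof.
move=> uf; split; last by move=> s; apply: exp_unit; exact: resample_unit.
apply: (measurableT_comp (fine_measurable measurableT)).
apply: (@measurable_fun_fubini_tonelli_F _ _ _ _ _ P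
  (fun u : config * T => (f (resample m u.2 u.1))%:E)).
- apply/measurable_EFinP; apply: (measurableT_comp (proj1 uf)).
  exact: measurable_resample.
- by move=> u; rewrite lee_fin; case/andP: (proj2 uf (resample m u.2 u.1)).
Qed.

Lemma resampled_mono m f : unit_valued f -> increasing f ->
  increasing (resampled m f).
Proof.
move=> uf fi s t st; apply: exp_le.
- by apply: unit_bounded; exact: resample_unit.
- by apply: unit_bounded; exact: resample_unit.
by move=> w; apply: fi; exact: inherit_mono.
Qed.

(** Resampling leaves the arguments of [h] unchanged. *)
Lemma resampled_pull m h f : unit_valued f -> reads_below m h ->
  resampled m (fun s => h s * f s) = (fun s => h s * resampled m f s).
Proof.
move=> uf hm; apply/funext => s; rewrite /resampled.
rewrite -(@expZ _ _ _ P (h s)); last by apply: unit_bounded; exact: resample_unit.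
apply: eq_Rintegral => w _; congr (_ * _).
by apply: hm => z; exact: inherit_below.
Qed.

Lemma resampled_reads_below m f : unit_valued f ->
  {ae P, forall w, forall z, (0 < k z w)%N} -> reads_below m (resampled m f).
Proof.
move=> uf kpos s t st; apply: exp_ae.
- by apply: unit_bounded; exact: resample_unit.
- by apply: unit_bounded; exact: resample_unit.
by apply: filterS kpos => w kw; rewrite /resample (inherit_eq_below kw st).
Qed.

Variable lambda : probability config R.
Hypothesis lambda_gibbs : gibbs k lambda.

(** The Gibbs property gives this equality on the intersections of an event of the
    coordinates from [m] on with an event of the coordinates below [m]; such
    intersections form a generating pi-system. The right-hand side is the law of
    the resampled configuration, as an image of the product of [lambda] and [P]. *)
Lemma gibbs_invariant m (A : set config) : measurable A ->
  lambda A = (\int[lambda]_s P [set w | A (resample m w s)])%E.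
Proof.
move=> mA.
have mphi := measurable_resample m.
pose phi (u : config * T) : config := resample m u.2 u.1.
pose nu : {measure set config -> \bar R} :=
  measure_function_pushforward__canonical__measure_function_Measure
    (lambda \x P)%E mphi.
pose G : set (set config) := [set C | exists B D,
  [/\ <<s coordinate_events (half_line m) >> B,
      <<s coordinate_events (~` half_line m) >> D & C = B `&` D]].
have subm (S : set int) : <<s coordinate_events S >> `<=` (measurable : set (set config)).
  by apply: sub_sigma_algebra2 => _ [z [b [_ ->]]]; exists z, b.
have T0 (S : set int) : <<s coordinate_events S >> setT.
  exact: (@measurableT _ (g_sigma_algebraType (coordinate_events S))).
have SI (S : set int) : setI_closed (<<s coordinate_events S >>).
  move=> B D mB mD.
  exact: (@measurableI _ (g_sigma_algebraType (coordinate_events S))).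
have GI : setI_closed G.
  move=> _ _ [B [D [mB mD ->]]] [B' [D' [mB' mD' ->]]].
  exists (B `&` B'), (D `&` D'); split; [exact: SI|exact: SI|].
  by rewrite setIACA.
have GT : G setT by exists setT, setT; rewrite setTI.
have mG : (measurable : set (set config)) = <<s G >>.
  apply/seteqP; split; last first.
    apply: smallest_sub; first exact: sigma_algebra_measurable.
    by move=> _ [B [D [mB mD ->]]]; exact: measurableI (subm _ _ mB) (subm _ _ mD).
  apply: smallest_sub; first exact: smallest_sigma_algebra.
  move=> _ [z [b [_ ->]]]; apply: sub_sigma_algebra.
  have [zm|zm] := pselect (half_line m z).
    exists [set s | s z = b], setT; split => //; last by rewrite setIT.
    by apply: sub_sigma_algebra; exists z, b.
  exists setT, [set s | s z = b]; split => //; last by rewrite setTI.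
  by apply: sub_sigma_algebra; exists z, b.
transitivity (nu A); last first.
  rewrite /pushforward /product_measure1; apply: eq_integral => s _ /=.
  by congr (P _); apply/seteqP; split=> w; rewrite /xsection /= inE.
apply: (measure_unique G (fun=> setT)) => //=.
- exact: bigcup_const.
- move=> _ [B [D [mB mD ->]]].
  have [_ /(_ _ mD) ->] := lambda_gibbs mB.
  rewrite /pushforward /product_measure1 integral_mkcond.
  apply: eq_integral => s _ /=; rewrite patchE.
  have Dphi w : D (resample m w s) = D s.
    by apply: (generated_reads_below mD) => z; exact: inherit_below.
  case: ifPn; rewrite ?inE ?notin_setE => Ds.
    congr (P _); apply/seteqP; split=> w; rewrite /xsection /= inE /=.
      by move=> Bw; split=> //; rewrite Dphi.
    by case.
  rewrite (_ : xsection _ _ = set0) ?measure0//.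
  by apply/seteqP; split=> w //; rewrite /xsection /= inE /= Dphi => -[].
- by move=> _; rewrite (le_lt_trans (probability_le1 _ _))// ltry.
Qed.

Lemma exp_resampled m f : unit_valued f ->
  \int[lambda]_s resampled m f s = \int[lambda]_s f s.
Proof.
move=> uf.
have mphi := measurable_resample m.
pose phi (u : config * T) : config := resample m u.2 u.1.
pose nu : {measure set config -> \bar R} :=
  measure_function_pushforward__canonical__measure_function_Measure
    (lambda \x P)%E mphi.
have f0 s : (0 <= (f s)%:E)%E by rewrite lee_fin; case/andP: (proj2 uf s).
have mf : measurable_fun setT (EFin \o f) by apply/measurable_EFinP; case: uf.
apply: EFin_inj; rewrite !EFin_Rintegral; try exact/unit_bounded/resampled_unit;
  try exact: unit_bounded.
transitivity (\int[nu]_s (f s)%:E)%E; last first.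
  apply: eq_measure_integral => A mA _; rewrite [RHS](gibbs_invariant m)//.
  rewrite /pushforward /= /product_measure1; apply: eq_integral => s _ /=.
  by congr (P _); apply/seteqP; split=> w; rewrite /xsection /= inE.
rewrite ge0_integral_pushforward// preimage_setT.
rewrite fubini_tonelli1//=.
  apply: eq_integral => s _; rewrite /fubini_F /= EFin_Rintegral//.
  by apply: unit_bounded; exact: resample_unit.
exact: measurableT_comp.
Qed.

(** The projection property of conditional expectations. *)
Lemma exp_resampled_pull m h f : unit_valued f -> unit_valued h ->
  reads_below m h ->
  \int[lambda]_s (h s * resampled m f s) = \int[lambda]_s (h s * f s).
Proof.
move=> uf uh hm; rewrite -(exp_resampled m (unit_valuedM uh uf)).
by rewrite resampled_pull.
Qed.

End resampling.

(** * Monotonicity in the level of resampling *)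

Section correlation.
Context {R : realType} {dT : measure_display} {T : measurableType dT}.
Variables (P : probability T R) (k : int -> {RV P >-> nat}).
Hypothesis kpos : {ae P, forall w, forall z, (0 < k z w)%N}.
Variable lambda : probability config R.
Hypothesis lambda_gibbs : gibbs k lambda.

Local Notation K m f := (resampled k m f).
Local Notation E f := (\int[lambda]_s f s).

(** The resampling reaches [f] and [g] only through the value at [m], and two
    increasing functions of a single bit are positively correlated. *)
Lemma resampledM_ge m (f g : config -> R) s : unit_valued f -> unit_valued g ->
  reads_below (m + 1) f -> reads_below (m + 1) g -> increasing f -> increasing g ->
  K m f s * K m g s <= K m (fun t => f t * g t) s.
Proof.
move=> uf ug fm gm fi gi.
pose set_bit b : config := fun z => if z == m then b else s z.
pose B := [set w | resample k m w s m = true].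
have mB : measurable B.
  have := measurable_resample_graph k m s measurableT (coordinate_measurable m true).
  by rewrite setTI.
have bitE (h : config -> R) w : reads_below (m + 1) h -> h (resample k m w s) =
    h (set_bit false) + (h (set_bit true) - h (set_bit false)) * \1_B w.
  move=> hm; rewrite (hm _ (set_bit (resample k m w s m))); last first.
    move=> z zm; rewrite /set_bit; case: eqVneq => [->//|zNm].
    by apply: inherit_below; lia.
  rewrite indicE; case e : (resample k m w s m).
    by rewrite mem_set//= mulr1 addrC subrK.
  by rewrite memNset ?mulr0 ?addr0// /B /= e.
have KE (h : config -> R) : reads_below (m + 1) h -> K m h s =
    h (set_bit false) + (h (set_bit true) - h (set_bit false)) * fine (P B).
  move=> hm; transitivity (\int[P]_w (h (set_bit false) +
      (h (set_bit true) - h (set_bit false)) * \1_B w)).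
    by apply: eq_Rintegral => w _; exact: bitE.
  have bB := bounded_measurable_indic (R := R) mB.
  rewrite expD ?exp_cst ?expZ ?exp_indic//; first exact: bounded_measurable_cst.
  by apply: bounded_measurableM => //; exact: bounded_measurable_cst.
have fgm : reads_below (m + 1) (fun t => f t * g t).
  by move=> t t' tt'; rewrite (fm _ _ tt') (gm _ _ tt').
rewrite !KE//.
have mono (h : config -> R) : increasing h -> h (set_bit false) <= h (set_bit true).
  by apply => z; rewrite /set_bit; case: ifP.
have := mono f fi; have := mono g gi.
have : 0 <= fine (P B) <= 1.
  by rewrite -exp_indic//; apply: exp_unit; exact: unit_valued_indic.
move: (f _) (f _) (g _) (g _) (fine _) => a' a c' c q /andP[q0 q1] cc aa.
(* the covariance of two functions of a bit that is set with probability [q] *)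
rewrite -subr_ge0 (_ : _ - _ = (a' - a) * (c' - c) * (q * (1 - q))); last by ring.
by apply: mulr_ge0; apply: mulr_ge0; rewrite ?subr_ge0.
Qed.

(** Both sides equal the expectation of [h * X]. *)
Lemma exp_resampled_tower m n (h X : config -> R) : m <= n -> unit_valued h ->
  unit_valued X -> reads_below m h ->
  E (fun s => h s * K m X s) = E (fun s => h s * K m (K n X) s).
Proof.
move=> mn uh uX hm; have uKX := resampled_unit k n uX.
by rewrite !exp_resampled_pull//; exact: reads_below_le hm.
Qed.

Let KbE m X : unit_valued X -> reads_below m (K m X).
Proof. by move=> uX; exact: resampled_reads_below. Qed.

Let EC (f g : config -> R) : E (fun s => f s * g s) = E (fun s => g s * f s).
Proof. by apply: eq_Rintegral => s _; rewrite mulrC. Qed.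

(** By the tower property, the two factors at level [m] may be replaced by the
    resamplings at [m] of the factors at level [m + 1]; these read only one
    resampled coordinate, so the inequality for a single bit applies. *)
Lemma exp_resampled_step m (X Y : config -> R) : unit_valued X -> unit_valued Y ->
  increasing X -> increasing Y ->
  E (fun s => K m X s * K m Y s) <= E (fun s => K (m + 1) X s * K (m + 1) Y s).
Proof.
move=> uX uY iX iY; have mm1 : m <= m + 1 by lia.
have uK n Z : unit_valued Z -> unit_valued (K n Z) by exact: resampled_unit.
rewrite (exp_resampled_tower mm1)//; [|exact: uK|exact: KbE].
rewrite EC (exp_resampled_tower mm1)//; [|exact/uK/uK|exact/KbE/uK].
have u1 := uK (m + 1) _ uX; have u2 := uK (m + 1) _ uY.
rewrite -(exp_resampled lambda_gibbs m (unit_valuedM u1 u2)).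
apply: exp_le.
- by apply/unit_bounded/unit_valuedM; exact: uK.
- by apply/unit_bounded/uK; exact: unit_valuedM.
move=> s; rewrite mulrC; apply: resampledM_ge => //; [exact: KbE|exact: KbE| |];
  exact: resampled_mono.
Qed.

Lemma exp_resampled_le m n (X Y : config -> R) : unit_valued X -> unit_valued Y ->
  increasing X -> increasing Y -> m <= n ->
  E (fun s => K m X s * K m Y s) <= E (fun s => K n X s * K n Y s).
Proof.
move=> uX uY iX iY mn; rewrite -(subrK m n) addrC.
have -> : n - m = `|n - m|%N by lia.
elim: `|n - m|%N => [|i /le_trans]; first by rewrite addr0.
by apply; rewrite -addn1 PoszD addrA; exact: exp_resampled_step.
Qed.

(** * Approximation by functions of the coordinates below a level *)

Definition local_approx (f : config -> R) (e : R) : Prop := exists m Z,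
  [/\ unit_valued Z, reads_below m Z & E (fun s => `|f s - Z s|) <= e].

Let bd (f g : config -> R) : unit_valued f -> unit_valued g ->
  bounded_measurable (fun s => `|f s - g s|).
Proof.
move=> uf ug; apply: bounded_measurable_norm.
by apply: bounded_measurableB; exact: unit_bounded.
Qed.

Lemma local_approxU (A B : set config) (e e' : R) : measurable A -> measurable B ->
  local_approx \1_A e -> local_approx \1_B e' -> local_approx \1_(A `|` B) (e + e').
Proof.
move=> mA mB [m [Z [uZ mZ eZ]]] [n [Z' [uZ' nZ' eZ']]].
have uA := unit_valued_indic (R := R) mA; have uB := unit_valued_indic (R := R) mB.
have uU := unit_valued_indic (R := R) (measurableU _ _ mA mB).
have uM : unit_valued (fun s => Num.max (Z s) (Z' s)).
  split; first by apply: measurable_maxr; [exact: (proj1 uZ)|exact: (proj1 uZ')].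
  move=> s; have := proj2 uZ s; have := proj2 uZ' s.
  by rewrite ge_max le_max => /andP[-> ->] /andP[-> ->]; rewrite orbT.
exists (Num.max m n), (fun s => Num.max (Z s) (Z' s)); split => //.
  move=> s t st; rewrite (mZ s t) ?(nZ' s t)// => z zm; apply: st;
    by rewrite lt_max zm ?orbT.
apply: le_trans (lerD eZ eZ'); rewrite -expD; [|exact: bd|exact: bd].
apply: exp_le; [exact: bd|by apply: bounded_measurableD; exact: bd|] => s.
have -> : \1_(A `|` B) s = Num.max (\1_A s) (\1_B s) :> R.
  rewrite !indicE in_setU; case: (s \in A); case: (s \in B) => /=;
    by rewrite /Order.max ?ltxx ?ltr01 ?ltr10.
move: (\1_A s) (\1_B s) (Z s) (Z' s) => a b z z'.
have := ler_norm (a - z); have := ler_norm (- (a - z)); rewrite normrN.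
have := ler_norm (b - z'); have := ler_norm (- (b - z')); rewrite normrN.
move: `|a - z| `|b - z'| => p q.
by rewrite ler_norml; case: (leP a b) => ab; case: (leP z z') => zz; lra.
Qed.

(** The events that can be approximated form a sigma-algebra containing the
    coordinate events; a countable union is first replaced by a finite one. *)
Lemma local_approx_event (A : set config) : measurable A ->
  forall e, 0 < e -> local_approx \1_A e.
Proof.
pose good (B : set config) := measurable B /\ forall e, 0 < e -> local_approx \1_B e.
suff gen : <<s coordinate_events setT >> `<=` good by move=> /gen[].
have u0 : unit_valued (fun _ : config => 0 : R).
  by split=> // s; rewrite lexx ler01.
have sgood : sigma_algebra (setT : set config) good; last first.
  apply: smallest_sub => // _ [z [b [_ ->]]]; split; first exact: coordinate_measurable.
  move=> e e0; exists (z + 1), \1_[set s : config | s z = b]; split.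
  + by apply: unit_valued_indic; exact: coordinate_measurable.
  + move=> s t st; rewrite !indicE; congr (_%:R); congr nat_of_bool.
    by apply/idP/idP; rewrite !inE /= st//; lia.
  rewrite (_ : (fun _ => _) = (fun=> 0)) ?exp_cst 1?ltW//.
  by apply/funext => s; rewrite subrr normr0.
split.
- split=> // e e0; exists 0, (fun=> 0); split => //.
  rewrite (_ : (fun _ => _) = (fun=> 0)) ?exp_cst 1?ltW//.
  by apply/funext => s; rewrite indic0 subr0 normr0.
- move=> B [mB aB]; rewrite setTD; split; first exact: measurableC.
  move=> e /aB[m [Z [uZ mZ eZ]]]; exists m, (fun s => 1 - Z s); split.
  + split; first by apply: measurable_funB => //; exact: (proj1 uZ).
    by move=> s; case/andP: (proj2 uZ s) => z0 z1; rewrite subr_ge0 z1/= gerBl.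
  + by move=> s t st; rewrite (mZ s t).
  apply: le_trans eZ; rewrite le_eqVlt; apply/orP; left; apply/eqP.
  apply: eq_Rintegral => s _; rewrite -normrN; congr (`|_|).
  by rewrite !indicE in_setC; case: (s \in B) => /=; ring.
- move=> F aF; have mF i : measurable (F i) by case: (aF i).
  have mUF : measurable (\bigcup_i F i) by exact: bigcupT_measurable.
  split=> // e e0.
  pose U n := \big[setU/set0]_(i < n) F i.
  have mU n : measurable (U n) by exact: bigsetU_measurable.
  have aU n : forall e, 0 < e -> local_approx \1_(U n) e.
    elim: n => [|n IHn] e' e'0; rewrite /U.
      rewrite big_ord0; exists 0, (fun=> 0); split => //.
      rewrite (_ : (fun _ => _) = (fun=> 0)) ?exp_cst 1?ltW//.
      by apply/funext => s; rewrite indic0 subr0 normr0.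
    rewrite big_ord_recr /= (splitr e'); apply: local_approxU => //.
    - exact: mU.
    - by apply: IHn; rewrite divr_gt0.
    - by apply: (aF n).2; rewrite divr_gt0.
  have UF : (fun n => fine (lambda (U n))) @ \oo --> fine (lambda (\bigcup_i F i)).
    apply: fine_cvg; rewrite fineK ?fin_num_measure//.
    have -> : \bigcup_i F i = \bigcup_n U n.
      apply/seteqP; split=> s [i _]; last first.
        by rewrite /U -bigcup_mkord => -[j _ Fj]; exists j.
      by move=> Fi; exists i.+1 => //; rewrite /U big_ord_recr; right.
    apply: nondecreasing_cvg_mu => //; first exact: bigcupT_measurable.
    by move=> i j ij; apply/subsetPset; exact: subset_bigsetU.
  have e20 : 0 < e / 2 by rewrite divr_gt0.
  move/cvgrPdist_le/(_ _ e20) : UF => [n _ /(_ n (leqnn n)) /= nU].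
  have [m [Z [uZ mZ eZ]]] := aU n _ e20.
  exists m, Z; split => //; rewrite (splitr e).
  have uF := unit_valued_indic (R := R) mUF.
  have uU := unit_valued_indic (R := R) (mU n).
  apply: le_trans (lerD nU eZ).
  apply: le_trans (_ : E (fun s => (\1_(\bigcup_i F i) s - \1_(U n) s) +
      `|\1_(U n) s - Z s|) <= _).
    apply: exp_le; first exact: bd.
      apply: bounded_measurableD; last exact: bd.
      by apply: bounded_measurableB; exact: unit_bounded.
    move=> s; rewrite -(ger0_norm (_ : 0 <= \1_(\bigcup_i F i) s - \1_(U n) s)).
      by rewrite (le_trans _ (ler_normD _ _))// addrA subrK.
    rewrite subr_ge0 !indicE ler_nat; case: (boolP (s \in U n)) => //.
    rewrite inE => Us; rewrite mem_set//.
    by move: Us; rewrite /U -bigcup_mkord => -[i _ Fi]; exists i.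
  rewrite expD; [|by apply: bounded_measurableB; exact: unit_bounded|exact: bd].
  rewrite expB; [|exact: unit_bounded|exact: unit_bounded].
  by rewrite !exp_indic// lerD2r ler_norm.
Qed.

(** Binary expansion: [X] is half the indicator of [1/2 <= X] plus half of a
    function with values in the unit interval, so each step halves the error
    inherited from the latter. *)
Lemma local_approx_dyadic n (X : config -> R) e : unit_valued X -> 0 < e ->
  local_approx X (e + 2^-1 ^+ n).
Proof.
elim: n X => [|n IHn] X uX e0.
  exists 0, (fun=> 0); split => //.
    by split=> // s; rewrite lexx ler01.
  rewrite expr0; apply: (@le_trans _ _ 1); last by rewrite lerDr ltW.
  rewrite -[leRHS](exp_cst lambda 1); apply: exp_le.
  - by apply: bd => //; split=> // s; rewrite lexx ler01.
  - exact: bounded_measurable_cst.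
  by move=> s; case/andP: (proj2 uX s) => x0 x1; rewrite subr0 ger0_norm.
pose A := [set s | 2^-1 <= X s].
have mA : measurable A.
  rewrite -[A]setTI (_ : A = X @^-1` `[2^-1, +oo[%classic).
    by apply: (proj1 uX) => //; exact: measurable_itv.
  by apply/seteqP; split=> s; rewrite /A /= in_itv /= andbT.
have AE s : \1_A s = (2^-1 <= X s)%R%:R :> R.
  rewrite indicE; congr (_%:R); congr nat_of_bool.
  by apply/idP/idP; rewrite inE.
pose X' s := 2 * X s - \1_A s.
have uX' : unit_valued X'.
  split.
    apply: measurable_funB; last exact: measurable_indic.
    by apply: measurable_funM => //; exact: (proj1 uX).
  move=> s; rewrite /X' AE; have /andP[] := proj2 uX s.
  by case: (leP 2^-1 (X s)) => /= h x0 x1; apply/andP; split; lra.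
have [m [Z [uZ mZ eZ]]] := local_approx_event mA e0.
have [m' [Z' [uZ' mZ' eZ']]] := IHn X' uX' e0.
have uW : unit_valued (fun s => 2^-1 * (Z s + Z' s)).
  split.
    apply: measurable_funM => //.
    by apply: measurable_funD; [exact: (proj1 uZ)|exact: (proj1 uZ')].
  move=> s; have /andP[z0 z1] := proj2 uZ s; have /andP[z0' z1'] := proj2 uZ' s.
  by apply/andP; split; lra.
exists (Num.max m m'), (fun s => 2^-1 * (Z s + Z' s)); split => //.
  move=> s t st; rewrite (mZ s t) ?(mZ' s t)// => z zm; apply: st;
    by rewrite lt_max zm ?orbT.
have uA := unit_valued_indic (R := R) mA.
apply: (@le_trans _ _ (2^-1 * (E (fun s => `|\1_A s - Z s|) +
    E (fun s => `|X' s - Z' s|)))); last by rewrite exprS; lra.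
rewrite -expD; [|exact: bd|exact: bd].
rewrite -expZ; last by apply: bounded_measurableD; exact: bd.
apply: exp_le; first exact: bd.
  apply: bounded_measurableM; first exact: bounded_measurable_cst.
  by apply: bounded_measurableD; exact: bd.
move=> s; rewrite (_ : X s - _ = 2^-1 * ((\1_A s - Z s) + (X' s - Z' s))).
  by rewrite normrM ger0_norm// ler_wpM2l// ler_normD.
by rewrite /X'; field.
Qed.

Lemma local_approx_unit (X : config -> R) e : unit_valued X -> 0 < e ->
  local_approx X e.
Proof.
move=> uX e0; have e20 : 0 < e / 2 by rewrite divr_gt0.
have := @cvg_geometric R 1 2^-1; rewrite /geometric /=.
have h2 : `|2^-1 : R| < 1 by rewrite ger0_norm; lra.
move=> /(_ h2) /cvgrPdist_le/(_ _ e20)[n _ /(_ n (leqnn n))].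
rewrite /= sub0r normrN mul1r ger0_norm ?exprn_ge0// => ne.
have [m [Z [uZ mZ eZ]]] := local_approx_dyadic n uX e20.
by exists m, Z; split=> //; rewrite (le_trans eZ)// {2}(splitr e) lerD2l.
Qed.

(** A local approximation [Z] of [X] is not changed by resampling at a level [N]
    beyond the coordinates that it reads, so the expectations of [Z * Y] and of
    [Z * K N Y] agree. Exchanging [X] for [Z] and back costs the approximation
    error twice. This takes the place of martingale convergence as the level
    tends to plus infinity. *)
Lemma exp_resampled_le_exp m (X Y : config -> R) : unit_valued X -> unit_valued Y ->
  increasing X -> increasing Y ->
  E (fun s => K m X s * K m Y s) <= E (fun s => X s * Y s).
Proof.
move=> uX uY iX iY; apply/ler_addgt0Pr => e e0.
have e20 : 0 < e / 2 by rewrite divr_gt0.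
have [n [Z [uZ nZ eZ]]] := local_approx_unit uX e20.
pose N := Num.max m n.
have uK j V : unit_valued V -> unit_valued (K j V) by exact: resampled_unit.
have mN : m <= N by rewrite le_max lexx.
apply: (le_trans (exp_resampled_le uX uY iX iY mN)).
have close V W : unit_valued V -> unit_valued W -> forall U, unit_valued U ->
    E (fun s => V s * U s) <= E (fun s => W s * U s) + E (fun s => `|V s - W s|).
  move=> uV uW U uU.
  rewrite -expD; [|exact/unit_bounded/unit_valuedM|exact: bd].
  apply: exp_le; first exact/unit_bounded/unit_valuedM.
    apply: bounded_measurableD; last exact: bd.
    exact/unit_bounded/unit_valuedM.
  move=> s; rewrite -lerBlDl -mulrBl.
  have /andP[U0 U1] := proj2 uU s.
  by rewrite (le_trans (ler_norm _))// normrM (ger0_norm U0) ler_piMr.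
rewrite EC exp_resampled_pull//; [|exact: uK|exact: KbE].
rewrite EC (le_trans (close X Z uX uZ _ (uK N _ uY)))//.
rewrite exp_resampled_pull//; last first.
  by apply: reads_below_le nZ; rewrite le_max lexx orbT.
rewrite (splitr e) addrA lerD//.
apply: (le_trans (close Z X uZ uX _ uY)); rewrite lerD2l (le_trans _ eZ)//.
by rewrite le_eqVlt; apply/orP; left; apply/eqP; apply: eq_Rintegral => s _; rewrite distrC.
Qed.

End correlation.

(** * Triviality of the tail events under an extremal measure *)

Section tail.
Context {R : realType} {dT : measure_display} {T : measurableType dT}.
Variables (P : probability T R) (k : int -> {RV P >-> nat}).
Variable lambda : probability config R.

Definition tail_event (A : set config) : Prop :=
  measurable A /\ forall m, reads_below m A.

Lemma tail_eventC A : tail_event A -> tail_event (~` A).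
Proof.
move=> [mA tA]; split; first exact: measurableC.
by move=> m s t st; rewrite /setC /mkset (tA m s t).
Qed.

(** The Gibbs property for all events [C], including those that depend on the past. *)
Lemma gibbs_restrict m (C D : set config) : gibbs k lambda -> measurable C ->
  measurable D -> reads_below m D ->
  lambda (C `&` D) = (\int[lambda]_(s in D) P [set w | C (resample k m w s)])%E.
Proof.
move=> lg mC mD Dm; rewrite (gibbs_invariant lg m); last exact: measurableI.
rewrite [RHS]integral_mkcond; apply: eq_integral => s _; rewrite patchE.
have DE w : D (resample k m w s) = D s by apply: Dm => z; exact: inherit_below.
case: ifPn; rewrite ?inE ?notin_setE => Ds.
  congr (P _); apply/seteqP; split=> w /=; rewrite DE; first by case.
  by move=> Cw; split.
rewrite (_ : [set w | _] = set0) ?measure0//.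
by apply/seteqP; split=> w //= -[_]; rewrite DE.
Qed.

(** Restricting [lambda] to an event that every past determines does not affect
    the conditional laws given the past. The multiple of [lambda] restores the
    total mass, with the coefficient for which the measures built from [A] and
    from its complement have average [lambda]. *)
Lemma gibbs_tilt A : gibbs k lambda -> tail_event A ->
  exists nu : probability config R, gibbs k nu /\ forall B, measurable B ->
    nu B = ((1 - fine (lambda A))%:E * lambda B + lambda (B `&` A))%E.
Proof.
move=> lg [mA tA].
have pA : 0 <= 1 - fine (lambda A).
  rewrite subr_ge0 -lee_fin fineK ?fin_num_measure//.
  exact: probability_le1.
pose nu0 : {measure set config -> \bar R} :=
  measure_add (mscale (NngNum pA) lambda) (mrestr lambda mA).
have nu0E B : nu0 B = ((1 - fine (lambda A))%:E * lambda B + lambda (B `&` A))%E.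
  exact: measure_addE.
have nu0T : nu0 setT = 1%E.
  rewrite nu0E setTI probability_setT mule1 EFinB fineK ?fin_num_measure//.
  by rewrite subeK ?fin_num_measure.
pose nu : probability config R :=
  HB.pack (nu0 : set config -> \bar R) (Measure.on nu0)
    (Measure_isProbability.Build _ _ _ (nu0 : set config -> \bar R) nu0T).
have subm (S : set int) : <<s coordinate_events S >> `<=` (measurable : set (set config)).
  by apply: sub_sigma_algebra2 => _ [z [b [_ ->]]]; exists z, b.
exists nu; split; last by move=> B _; exact: nu0E.
move=> x C mC; have [mf fC] := lg x C mC; split=> // B mB.
pose f (s : config) := P [set w | C (inherit x (fun z => k z w) s)].
have mfT : measurable_fun [set: config] f.
  by move=> _ D mD; apply: (subm (~` half_line x)); exact: mf.
have f0 s : (0 <= f s)%E by exact: measure_ge0.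
have mB' := subm _ _ mB; have mC' := subm _ _ mC.
have mBf : measurable_fun B f by exact: measurable_funTS.
rewrite [LHS]nu0E.
have f0B s : B s -> (0 <= f s)%E by move=> _; exact: f0.
apply: etrans; last exact: (esym (ge0_integral_measure_add _ _ mB' f0B mBf)).
rewrite ge0_integral_mscale//; congr (_ + _)%E; first by rewrite fC.
rewrite -setIA (gibbs_restrict (m := x))//; last 2 first.
- exact: measurableI.
- by move=> s t st; rewrite /setI /mkset (tA x s t)// (generated_reads_below mB st).
rewrite (@ge0_negligible_integral _ _ _ (mrestr lambda mA) B (~` A))//; last 2 first.
- exact: measurableC.
- by rewrite /= /mrestr setICl measure0.
rewrite setDE setCK; apply: eq_measure_integral => D mD DBA.
by rewrite /= /mrestr setIidl// => s /DBA[].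
Qed.

(** The tilts of [lambda] by [A] and by its complement average to [lambda], so they
    coincide; with [p] the probability of [A], their values at [A] are
    [(1 - p) * p + p] and [p * p], which forces [p * (1 - p) = 0]. *)
Lemma extremal_tail_trivial A : extremal_gibbs k lambda -> tail_event A ->
  fine (lambda A) = 0 \/ fine (lambda A) = 1.
Proof.
move=> [lg ext] tA; have mA := tA.1.
have [nu1 [g1 nu1E]] := gibbs_tilt lg tA.
have [nu2 [g2 nu2E]] := gibbs_tilt lg (tail_eventC tA).
have fin B : measurable B -> lambda B \is a fin_num by move=> mB; rewrite fin_num_measure.
have lC : lambda (~` A) = (1 - fine (lambda A))%:E.
  by rewrite probability_setC// EFinB fineK ?fin.
have avg B : measurable B -> lambda B = ((2^-1)%:E * (nu1 B + nu2 B))%E.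
  move=> mB; rewrite nu1E// nu2E// lC /=.
  have mBA := measurableI _ _ mB mA; have mBC := measurableI _ _ mB (measurableC mA).
  have split_B : lambda B = (lambda (B `&` A) + lambda (B `&` ~` A))%E.
    rewrite -measureU//; first by rewrite -setIUr setUv setIT.
    by rewrite setIACA setICr setI0.
  move: split_B; rewrite -(fineK (fin _ mB)) -(fineK (fin _ mBA)) -(fineK (fin _ mBC)).
  rewrite -!EFinM -!EFinD => -[BE]; congr EFin.
  by rewrite BE; field.
have /= := ext nu1 nu2 g1 g2 avg A mA; rewrite nu1E// nu2E// lC /= setIid setICr measure0.
rewrite adde0 -(fineK (fin _ mA)) -!EFinM -EFinD => -[] /= e.
have : fine (lambda A) * (1 - fine (lambda A)) = 0 by lra.
by move=> /eqP; rewrite mulf_eq0 => /orP[/eqP|/eqP]; [left|right; lra].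
Qed.

End tail.

(** * Positive association *)

Section association.
Context {R : realType} {dT : measure_display} {T : measurableType dT}.
Variables (P : probability T R) (k : int -> {RV P >-> nat}).
Hypothesis kpos : {ae P, forall w, forall z, (0 < k z w)%N}.
Variable lambda : probability config R.
Hypothesis lambda_ext : extremal_gibbs k lambda.

Let lambda_gibbs : gibbs k lambda := lambda_ext.1.
Local Notation K m f := (resampled k m f).
Local Notation E f := (\int[lambda]_s f s).

Lemma measurable_lt_cst (f : config -> R) a : measurable_fun setT f ->
  measurable [set s | f s < a].
Proof.
move=> mf; rewrite -[X in measurable X]setTI (_ : [set s | _] = f @^-1` `]-oo, a[%classic).
  by apply: mf => //; exact: measurable_itv.
by apply/seteqP; split=> s; rewrite /= in_itv.
Qed.

Section one_function.
Variables (X : config -> R) (a : R).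
Hypothesis uX : unit_valued X.

Let low (i : nat) := [set s | K (- i%:Z) X s < a].
Let hit (n : nat) := [set s | exists i, (i < n)%N /\ low i s].

Let mlow i : measurable (low i).
Proof. by apply: measurable_lt_cst; exact: (proj1 (resampled_unit k _ uX)). Qed.

Let low_below i : reads_below (- i%:Z) (low i).
Proof.
by move=> s t st; rewrite /low /mkset (resampled_reads_below uX kpos st).
Qed.

Let mhit n : measurable (hit n).
Proof.
apply: measurable_exists => i; have [_|ni] := ltnP i n.
  by rewrite (_ : [set _ | _] = low i)//; apply/seteqP; split=> s; [case|split].
by rewrite (_ : [set _ | _] = set0)//; apply/seteqP; split=> s [].
Qed.

(** Optional stopping at the leftmost level, among the last [n], where the
    resampled expectation is below [a]. The induction adds levels on the left,
    so it must allow any event [G] of the past of all of them. *)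
Let exp_hit n (G : set config) : measurable G -> reads_below (1 - n%:Z) G ->
  E (fun s => \1_(hit n `&` G) s * X s) <= a * E (\1_(hit n `&` G)).
Proof.
elim: n G => [|n IHn] G mG Gn.
  have -> : hit 0 = set0 by apply/seteqP; split=> s // [i []].
  rewrite set0I indic0 (_ : (fun _ => _) = (fun=> 0)) ?exp_cst ?mulr0//.
  by apply/funext => s; rewrite /= mul0r.
have {}Gn : reads_below (- n%:Z) G by apply: reads_below_le Gn; lia.
(* the leftmost hit is either at the new level, or at one of the previous ones *)
pose L := low n `&` G; pose H := hit n `&` (G `\` low n).
have mL : measurable L by exact: measurableI.
have mH : measurable H by apply: measurableI => //; exact: measurableD.
have uL := unit_valued_indic (R := R) mL; have uH := unit_valued_indic (R := R) mH.
have split_hit s : \1_(hit n.+1 `&` G) s = \1_L s + \1_H s :> R.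
  have LH : ~ (L s /\ H s) by move=> [[l _] [_ [_ nl]]].
  rewrite !indicE; have [Ls|nL] := pselect (L s).
    rewrite (mem_set Ls) (memNset (A := H)); last by move=> Hs; apply: LH.
    rewrite mem_set ?addr0//; case: Ls => ls Gs; split=> //.
    by exists n; split.
  rewrite (memNset nL) add0r; congr (_%:R); congr nat_of_bool; apply/idP/idP; rewrite !inE.
    move=> [[i [ni li]] Gs]; have nlow : ~ low n s by move=> ls; apply: nL.
    split=> //; exists i; split=> //; rewrite ltn_neqAle -ltnS ni andbT.
    by apply/eqP => ein; apply: nlow; rewrite -ein.
  by move=> [[i [ni li]] [Gs _]]; split=> //; exists i; rewrite ltnS ltnW.
rewrite (_ : (fun _ => _) = (fun s => \1_L s * X s + \1_H s * X s)); last first.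
  by apply/funext => s; rewrite split_hit mulrDl.
rewrite (_ : \1_(hit n.+1 `&` G) = (fun s => \1_L s + \1_H s)); last first.
  by apply/funext => s; exact: split_hit.
have buL := unit_bounded (unit_valuedM uL uX).
have buH := unit_bounded (unit_valuedM uH uX).
have bL := unit_bounded uL; have bH := unit_bounded uH.
rewrite !expD// mulrDr lerD//; last first.
  apply: IHn; first exact: measurableD.
  apply: (@reads_below_le _ (- n%:Z)); first lia.
  move=> s t st; rewrite /setD /mkset (Gn _ _ st).
  by rewrite (_ : low n s = low n t)//; exact: low_below.
rewrite -(exp_resampled_pull lambda_gibbs (m := - n%:Z))//; last first.
  move=> s t st; rewrite !indicE /L !in_setI /in_mem /= /in_set.
  by rewrite (Gn _ _ st) (low_below st).
rewrite -expZ//; apply: exp_le.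
- by apply/unit_bounded/unit_valuedM => //; exact: resampled_unit.
- by apply: bounded_measurableM => //; exact: bounded_measurable_cst.
move=> s; rewrite indicE; case: (boolP (s \in L)) => [|_].
  by rewrite inE => -[ls _] /=; rewrite mul1r mulr1 ltW.
by rewrite /= mul0r mulr0.
Qed.

(** Backward convergence of the resampled expectations: if they fell below [a]
    at arbitrarily low levels almost surely, stopping there would bound the
    expectation of [X] by [a]. By tail triviality they eventually exceed every
    [a] smaller than the expectation. *)
Lemma resampled_eventually_ge e : 0 <= a -> a < E X -> 0 < e ->
  exists j, forall i, (j <= i)%N -> 1 - e <= E (\1_[set s | a <= K (- i%:Z) X s]).
Proof.
move=> a0 aX e0.
pose io := [set s | forall j, exists i, (j <= i)%N /\ low i s].
have mjlow j : measurable [set s | exists i, (j <= i)%N /\ low i s].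
  apply: measurable_exists => i; have [_|ji] := leqP j i.
    by rewrite (_ : [set _ | _] = low i)//; apply/seteqP; split=> s; [case|split].
  by rewrite (_ : [set _ | _] = set0)//; apply/seteqP; split=> s [].
have tio : tail_event io.
  split; first by apply: measurable_forall => j; exact: mjlow.
  suff sub m s t : (forall z, z < m -> s z = t z) -> io s -> io t.
    move=> m s t st; apply/propext; split; apply: (sub m) => // z zm.
    by rewrite st.
  move=> st ios j; have [i [ji li]] := ios (maxn j `|m|%N).
  exists i; split; first by rewrite (leq_trans _ ji)// leq_maxl.
  rewrite -(low_below (i := i) (s := s))// => z zi; apply: st.
  by have := leq_trans (leq_maxr j `|m|%N) ji; lia.
have mio := tio.1.
have io0 : fine (lambda io) = 0.
  have [//|io1] := extremal_tail_trivial lambda_ext tio.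
  suff : E X <= a by rewrite leNgt aX.
  have hit1 : (fun n => fine (lambda (hit n))) @ \oo --> (1 : R).
    have -> : 1 = fine (lambda (\bigcup_n hit n)).
      apply/eqP; rewrite eq_le; apply/andP; split.
        rewrite -io1 fine_le ?fin_num_measure//; first exact: bigcupT_measurable.
        apply: le_measure; rewrite ?inE//; first exact: bigcupT_measurable.
        by move=> s /(_ 0%N)[i [_ li]]; exists i.+1 => //; exists i.
      rewrite -lee_fin fineK ?fin_num_measure//; last exact: bigcupT_measurable.
      by apply: probability_le1; exact: bigcupT_measurable.
    apply: fine_cvg; rewrite fineK ?fin_num_measure//; last exact: bigcupT_measurable.
    apply: nondecreasing_cvg_mu => //; first exact: bigcupT_measurable.
    move=> i j ij; apply/subsetPset => s [l [li ls]]; exists l; split=> //.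
    exact: leq_trans ij.
  apply/ler_addgt0Pr => d d0.
  move/cvgrPdist_le/(_ _ d0) : hit1 => [n _ /(_ n (leqnn n)) /= nd].
  have mh := mhit n.
  have uh := unit_valued_indic (R := R) mh.
  have := exp_hit (n := n) measurableT; rewrite setIT => /(_ _)/wrap[//|hX].
  have le_split : E X <= E (fun s => \1_(hit n) s * X s + (1 - \1_(hit n) s)).
    have bc := bounded_measurable_cst (1 : R).
    apply: exp_le; first exact: unit_bounded.
      apply: bounded_measurableD; first exact/unit_bounded/unit_valuedM.
      by apply: bounded_measurableB => //; exact: unit_bounded.
    move=> s; rewrite indicE; have /andP[_ X1] := proj2 uX s.
    by case: (_ \in _) => /=; lra.
  have bh := unit_bounded uh; have bhX := unit_bounded (unit_valuedM uh uX).
  have b1 := bounded_measurable_cst (1 : R).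
  rewrite expD// in le_split; last exact: bounded_measurableB.
  rewrite expB// exp_cst in le_split.
  have /andP[h0 h1] := exp_unit lambda uh.
  apply: (le_trans le_split); rewrite lerD//.
    by rewrite (le_trans hX)// ler_piMr.
  by rewrite exp_indic// (le_trans (ler_norm _)).
have nio1 : (fun j => fine (lambda (~` [set s | exists i, (j <= i)%N /\ low i s])))
    @ \oo --> (1 : R).
  have mU : measurable (\bigcup_j ~` [set s | exists i, (j <= i)%N /\ low i s]).
    by apply: bigcupT_measurable => j; exact: measurableC.
  have -> : 1 = fine (lambda (\bigcup_j ~` [set s | exists i, (j <= i)%N /\ low i s])).
    rewrite -[LHS]subr0 -io0 -[1]/(fine 1%E) -fineB ?fin_num_measure//.
    rewrite -probability_setC//; congr (fine (lambda _)).
    apply/seteqP; split=> s.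
      by move=> /existsNP[j nj]; exists j.
    by move=> [j _ nj] ios; apply: nj; exact: ios.
  apply: fine_cvg; rewrite fineK ?fin_num_measure//.
  apply: nondecreasing_cvg_mu => //; first by move=> j; exact: measurableC.
  move=> i j ij; apply/subsetPset => s /= ni [l [jl ls]]; apply: ni.
  by exists l; split=> //; exact: leq_trans jl.
move/cvgrPdist_le/(_ _ e0) : nio1 => [j _ /(_ j (leqnn j)) /= je].
exists j => i ji; have mK : measurable [set s | a <= K (- i%:Z) X s].
  rewrite (_ : [set s | _] = ~` low i); first exact: measurableC.
  by apply/seteqP; split=> s; rewrite /low /= leNgt => /negP.
rewrite exp_indic// lerBlDr -lerBlDl (le_trans _ je)//.
rewrite (le_trans _ (ler_norm _))// lerB// fine_le ?fin_num_measure//.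
  exact: measurableC.
apply: le_measure; rewrite ?inE//; first exact: measurableC.
move=> s /= ns; rewrite leNgt; apply/negP => li; apply: ns; by exists i.
Qed.

End one_function.

(** Bookkeeping of errors for the next lemma: there [u] and [v] bound from below the
    probabilities that the resampled functions exceed [x - d] and [y - d]. *)
Lemma shrunk_product (x y d e u v p : R) : 0 <= x <= 1 -> 0 <= y <= 1 ->
  0 <= d -> d <= x -> d <= y -> d <= e / 4 -> 1 - d <= u -> 1 - d <= v ->
  (x - d) * (y - d) * (u + v - 1) <= p -> x * y <= p + e.
Proof.
move=> /andP[x0 x1] /andP[y0 y1] d0 dx dy de du dv.
have ab0 : 0 <= (x - d) * (y - d) by rewrite mulr_ge0 ?subr_ge0.
have ab1 : (x - d) * (y - d) <= 1 by apply: mulr_ile1; rewrite ?subr_ge0//; lra.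
have := ler_wpM2l ab0 (_ : 1 - 2 * d <= u + v - 1).
move=> /(_ ltac:(lra)) h1 h2.
have h3 : 0 <= (1 - (x - d) * (y - d)) * d by rewrite mulr_ge0 ?subr_ge0.
have h4 : 0 <= (1 - x) * d by rewrite mulr_ge0 ?subr_ge0.
have h5 : 0 <= (1 - y) * d by rewrite mulr_ge0 ?subr_ge0.
have := sqr_ge0 d; rewrite expr2.
lra.
Qed.

(** Fix constants slightly below the expectations of [X] and [Y]. At a sufficiently
    low level both resampled functions exceed these constants with probability
    close to one, so the expectation of their product is nearly the product of
    the constants; and it is at most the expectation of [X * Y]. *)
Lemma unit_positive_association (X Y : config -> R) :
  unit_valued X -> unit_valued Y -> increasing X -> increasing Y ->
  E X * E Y <= E (fun s => X s * Y s).
Proof.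
move=> uX uY iX iY.
have /andP[x0 x1] := exp_unit lambda uX; have /andP[y0 y1] := exp_unit lambda uY.
have /andP[xy0 _] := exp_unit lambda (unit_valuedM uX uY).
have [X0|Xn0] := eqVneq (E X) 0; first by rewrite X0 mul0r.
have [Y0|Yn0] := eqVneq (E Y) 0; first by rewrite Y0 mulr0.
have {Xn0}xp : 0 < E X by rewrite lt_def Xn0.
have {Yn0}yp : 0 < E Y by rewrite lt_def Yn0.
apply/ler_addgt0Pr => e e0.
pose d := Num.min (e / 4) (Num.min (E X) (E Y)).
have d0 : 0 < d by rewrite !lt_min xp yp divr_gt0.
have [de dx dy] : [/\ d <= e / 4, d <= E X & d <= E Y].
  by rewrite /d !ge_min !lexx !orbT.
have [a0 aX] : 0 <= E X - d /\ E X - d < E X by split; lra.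
have [b0 bY] : 0 <= E Y - d /\ E Y - d < E Y by split; lra.
have [i1 h1] := resampled_eventually_ge uX a0 aX d0.
have [i2 h2] := resampled_eventually_ge uY b0 bY d0.
pose i := maxn i1 i2.
have {}h1 := h1 i (leq_maxl _ _); have {}h2 := h2 i (leq_maxr _ _).
have le1 := exp_resampled_le_exp kpos lambda_gibbs (- i%:Z) uX uY iX iY.
set a := E X - d in a0 aX h1; set b := E Y - d in b0 bY h2.
pose A := [set s | a <= K (- i%:Z) X s]; pose B := [set s | b <= K (- i%:Z) Y s].
have uKX := resampled_unit k (- i%:Z) uX; have uKY := resampled_unit k (- i%:Z) uY.
have ge_measurable (f : config -> R) c : unit_valued f -> measurable [set s | c <= f s].
  move=> uf; rewrite (_ : [set s | _] = ~` [set s | f s < c]).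
    by apply: measurableC; apply: measurable_lt_cst; case: uf.
  by apply/seteqP; split=> s; rewrite /= leNgt => /negP.
have bA := unit_bounded (unit_valued_indic (R := R) (ge_measurable _ a uKX)).
have bB := unit_bounded (unit_valued_indic (R := R) (ge_measurable _ b uKY)).
have bc := bounded_measurable_cst (1 : R).
(* [\1_A + \1_B - 1] is at most the indicator of the intersection *)
have le2 : E (fun s => a * b * (\1_A s + \1_B s - 1)) <=
    E (fun s => K (- i%:Z) X s * K (- i%:Z) Y s).
  apply: exp_le; last 1 first.
  - move=> s; have /andP[KX0 _] := proj2 uKX s; have /andP[KY0 _] := proj2 uKY s.
    rewrite !indicE; case: (boolP (s \in A)); case: (boolP (s \in B));
      rewrite ?inE ?notin_setE /A /B /= => hB hA.
    + by rewrite addrK mulr1 ler_pM.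
    + by rewrite addr0 subrr mulr0 mulr_ge0.
    + by rewrite add0r subrr mulr0 mulr_ge0.
    + by rewrite addr0 sub0r mulrN1 (le_trans _ (mulr_ge0 KX0 KY0))// oppr_le0 mulr_ge0.
  - apply: bounded_measurableM; first exact: bounded_measurable_cst.
    by apply: bounded_measurableB => //; exact: bounded_measurableD.
  - exact/unit_bounded/unit_valuedM.
rewrite expZ in le2; last by apply: bounded_measurableB => //; exact: bounded_measurableD.
rewrite expB// ?exp_cst ?expD// in le2; last exact: bounded_measurableD.
apply: (shrunk_product (d := d) (u := E \1_A) (v := E \1_B)) => //.
- by rewrite x0.
- by rewrite y0.
- by rewrite ltW.
- exact: le_trans le2 le1.
Qed.

End association.

(** * From bounded to square-integrable functions *)

Section square_integrable.
Context {R : realType} {dT : measure_display} {T : measurableType dT}.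
Variables (P : probability T R) (k : int -> {RV P >-> nat}).
Hypothesis kpos : {ae P, forall w, forall z, (0 < k z w)%N}.
Variable lambda : probability config R.
Hypothesis lambda_ext : extremal_gibbs k lambda.
Local Notation E f := (\int[lambda]_s f s).

Definition clip (n : nat) (x : R) : R := Num.max (- n%:R) (Num.min n%:R x).

Lemma clip_norm n x : `|clip n x| <= `|x|.
Proof.
have n0 : 0 <= n%:R :> R by [].
rewrite /clip; have [nx|nx] := leP n%:R x.
  have -> : Num.max (- n%:R) n%:R = n%:R :> R by apply: max_r; lra.
  by rewrite !ger0_norm// (le_trans n0).
have [xn|xn] := leP (- n%:R) x => //.
by rewrite normrN ger0_norm// ler0_norm; lra.
Qed.

Lemma clip_bound n x : - n%:R <= clip n x <= n%:R.
Proof.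
have n0 : 0 <= n%:R :> R by [].
by rewrite /clip le_max lexx/= ge_max ge_min lexx/= andbT; lra.
Qed.

Lemma clip_mono n : {homo clip n : x y / x <= y}.
Proof. by move=> x y xy; apply: le_max2 => //; exact: le_min2. Qed.

Lemma measurable_clip n (f : config -> R) : measurable_fun setT f ->
  measurable_fun setT (fun s => clip n (f s)).
Proof.
by move=> mf; apply: measurable_maxr => //; exact: measurable_minr.
Qed.

Lemma clip_cvg x : clip n x @[n --> \oo] --> x.
Proof.
apply: cvg_near_cst; exists (Num.bound `|x|) => // n /= bn.
have xn : `|x| <= n%:R.
  by rewrite (le_trans (ltW (archi_boundP (normr_ge0 x))))// ler_nat.
move: xn; rewrite ler_norml => /andP[nx xn].
by rewrite /clip (min_r xn) (max_r nx).
Qed.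

(** The difference of the two sides is a covariance, so an increasing affine change
    of variables only multiplies it by a positive constant; one such change brings
    the values into the unit interval. The successor keeps the scale nonzero. *)
Lemma clip_positive_association n (X Y : config -> R) :
  measurable_fun setT X -> measurable_fun setT Y -> increasing X -> increasing Y ->
  E (fun s => clip n.+1 (X s)) * E (fun s => clip n.+1 (Y s)) <=
  E (fun s => clip n.+1 (X s) * clip n.+1 (Y s)).
Proof.
move=> mX mY iX iY; set N : R := n.+1%:R; have N0 : 0 < N by rewrite ltr0n.
pose c : R := (2 * N)^-1; have c0 : 0 < c by rewrite invr_gt0 mulr_gt0.
have cN : c * (2 * N) = 1 by rewrite mulVf// gt_eqF// mulr_gt0.
pose scale (Z : config -> R) s := c * (clip n.+1 (Z s) + N).
have b_clip (Z : config -> R) : measurable_fun setT Z ->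
    bounded_measurable (fun s => clip n.+1 (Z s)).
  move=> mZ; split; first exact: measurable_clip.
  by exists N => s; rewrite ler_norml clip_bound.
have uscale (Z : config -> R) : measurable_fun setT Z -> unit_valued (scale Z).
  move=> mZ; split.
    apply: (bounded_measurableM (bounded_measurable_cst c) _).1.
    exact: bounded_measurableD (b_clip _ mZ) (bounded_measurable_cst N).
  move=> s; have /andP[l u] := clip_bound n.+1 (Z s).
  rewrite /scale mulr_ge0 ?(ltW c0)//=; last by rewrite -lerBlDr sub0r.
  by rewrite -cN; apply: ler_wpM2l; [exact: ltW|rewrite mulrDl mul1r lerD].
have iscale (Z : config -> R) : increasing Z -> increasing (scale Z).
  move=> iZ s t st; apply: ler_wpM2l; first exact: ltW.
  by rewrite lerD2r; apply: clip_mono; exact: iZ.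
have := unit_positive_association kpos lambda_ext (uscale _ mX) (uscale _ mY)
  (iscale _ iX) (iscale _ iY).
have bX := b_clip _ mX; have bY := b_clip _ mY.
have bc := bounded_measurable_cst (T := config) N.
have bXY := bounded_measurableM bX bY.
have bNX := bounded_measurableM bc bX; have bNY := bounded_measurableM bc bY.
rewrite /scale !expZ; try exact: bounded_measurableD.
rewrite !expD// exp_cst.
rewrite (_ : (fun s => _ * _) = (fun s => (c * c) *
  (clip n.+1 (X s) * clip n.+1 (Y s) + N * clip n.+1 (X s) +
    (N * clip n.+1 (Y s) + N * N)))); last first.
  by apply/funext => s; ring.
have bcc := bounded_measurable_cst (T := config) (N * N).
have b1 := bounded_measurableD bXY bNX.
have b2 := bounded_measurableD bNY bcc.
rewrite expZ; last exact: bounded_measurableD.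
rewrite !expD// !expZ// exp_cst.
set a := Rintegral _ _ _; set b := Rintegral _ _ (fun s => clip _ (Y s)).
rewrite (_ : c * (a + N) * (c * (b + N)) = (c * c) * (a * b + N * a + (N * b + N * N))).
  by rewrite ler_pM2l ?mulr_gt0// !lerD2r.
by ring.
Qed.

Lemma exp_dominated_cvg (f_ : nat -> config -> R) (f g : config -> R) :
  (forall n, measurable_fun setT (f_ n)) ->
  (forall s, f_ n s @[n --> \oo] --> f s) ->
  lambda.-integrable setT (EFin \o f) ->
  lambda.-integrable setT (EFin \o g) ->
  (forall n s, `|f_ n s| <= g s) ->
  E (f_ n) @[n --> \oo] --> E f.
Proof.
move=> mf_ cf intf intg fg; apply: fine_cvg.
rewrite fineK; last exact: integrable_fin_num.
apply: (@dominated_cvg _ _ _ lambda setT measurableT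
  (fun n s => (f_ n s)%:E) (EFin \o f) (EFin \o g)) => //.
- by move=> n; exact/measurable_EFinP.
- by move=> s _; apply: cvg_EFin; [exact: nearW|exact: cf].
- by move=> n s _; rewrite /= lee_fin.
Qed.

Lemma square_integrable_positive_association (X Y : config -> R) :
  X \in Lfun lambda 2%:E -> Y \in Lfun lambda 2%:E ->
  increasing X -> increasing Y -> E X * E Y <= E (fun s => X s * Y s).
Proof.
move=> X2 Y2 iX iY.
have fl : lambda setT \is a fin_num by rewrite fin_num_measure.
have intX := (Lfun1_integrable _ _).1 (Lfun_subset12 fl X2).
have intY := (Lfun1_integrable _ _).1 (Lfun_subset12 fl Y2).
have intXY := (Lfun1_integrable _ _).1 (Lfun2_mul_Lfun1 X2 Y2).
have mX : measurable_fun setT X by apply/measurable_EFinP; exact: measurable_int intX.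
have mY : measurable_fun setT Y by apply/measurable_EFinP; exact: measurable_int intY.
have int_norm (f : config -> R) : lambda.-integrable setT (EFin \o f) ->
    lambda.-integrable setT (EFin \o (fun s => `|f s|)).
  by move=> intf; exact: integrable_norm.
have cvg1 (Z : config -> R) : measurable_fun setT Z ->
    lambda.-integrable setT (EFin \o Z) ->
    E (fun s => clip n.+1 (Z s)) @[n --> \oo] --> E Z.
  move=> mZ intZ.
  apply: (exp_dominated_cvg (g := fun s => `|Z s|)
    (f_ := fun n s => clip n.+1 (Z s))) => //.
  - by move=> n; exact: measurable_clip.
  - by move=> s; rewrite (cvg_shiftS (fun n => clip n (Z s))); exact: clip_cvg.
  - exact: int_norm.
  - by move=> n s; exact: clip_norm.
have cvg2 : E (fun s => clip n.+1 (X s) * clip n.+1 (Y s)) @[n --> \oo] -->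
    E (fun s => X s * Y s).
  apply: (exp_dominated_cvg (g := fun s => `|X s * Y s|)
    (f_ := fun n s => clip n.+1 (X s) * clip n.+1 (Y s))) => //.
  - by move=> n; apply: measurable_funM; exact: measurable_clip.
  - move=> s; apply: cvgM.
      by rewrite (cvg_shiftS (fun n => clip n (X s))); exact: clip_cvg.
    by rewrite (cvg_shiftS (fun n => clip n (Y s))); exact: clip_cvg.
  - exact: (int_norm (fun s => X s * Y s)).
  - by move=> n s; rewrite !normrM ler_pM// clip_norm.
apply: (@ler_cvg_to _ _ _ _ _ _ _ _ (cvgM (cvg1 _ mX intX) (cvg1 _ mY intY)) cvg2).
by apply: nearW => n; exact: clip_positive_association.
Qed.

End square_integrable.

Lemma random_graph_positive {R : realType} {dT : measure_display}
    {T : measurableType dT} (P : probability T R) (mu : probability nat R)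
    (k : int -> {RV P >-> nat}) :
  mu [set 0%N] = 0%E -> random_graph mu k ->
  {ae P, forall w, forall z, (0 < k z w)%N}.
Proof.
move=> mu0 [kmu _].
have kz z : {ae P, forall w, (0 < k z w)%N}.
  exists (k z @^-1` [set 0%N]); split.
  - by rewrite -[X in measurable X]setTI; exact: measurable_funPT.
  - by rewrite -mu0; exact: kmu.
  - by move=> w /= /negP; rewrite -eqn0Ngt => /eqP.
have kp : {ae P, forall w, forall n : nat, (0 < k (Posz n) w)%N}.
  by apply: ae_foralln => n; exact: kz.
have kn : {ae P, forall w, forall n : nat, (0 < k (Negz n) w)%N}.
  by apply: ae_foralln => n; exact: kz.
by apply: filterS2 kp kn => w hp hn [n|n]; [exact: hp|exact: hn].
Qed.

Theorem proposition4 (R : realType)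
    (* a probability measure on the positive integers *)
    (mu : probability nat R) (mu_pos : mu [set 0%N] = 0%E)
    (dT : measure_display) (T : measurableType dT) (P : probability T R)
    (k : int -> {RV P >-> nat}) (Gmu : random_graph mu k)
    (lambda : probability config R) (lambda_ext : extremal_gibbs k lambda)
    (X Y : config -> R)
    (XL2 : X \in Lfun lambda 2%:E) (YL2 : Y \in Lfun lambda 2%:E)
    (Xinc : increasing X) (Yinc : increasing Y) :
  (0 <= covariance lambda X Y)%E.
Proof.
have fl : lambda setT \is a fin_num by rewrite fin_num_measure.
have X1 := Lfun_subset12 fl XL2; have Y1 := Lfun_subset12 fl YL2.
have XY1 := Lfun2_mul_Lfun1 XL2 YL2.
rewrite covarianceE// sube_ge0 ?expectation_fin_num ?orbT//.
have EE (f : config -> R) : f \in Lfun lambda 1 ->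
    ('E_lambda[f])%E = (\int[lambda]_s f s)%:E.
  by move=> f1; rewrite unlock fineK// integrable_fin_num//; exact/Lfun1_integrable.
rewrite !EE// -EFinM lee_fin.
apply: square_integrable_positive_association => //.
  exact: random_graph_positive Gmu.
exact: lambda_ext.
Qed.
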